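(* Let $(X,d)$ be a locally connected metric space and $f:X\to X$ a continuous map. If $(X,f)$ is $\mathcal{N}$-sensitive, then $(X,f)$ is strongly $\beta$-$n$-sensitive, i.e. it is $\beta$-$n$-sensitive for every $n\in\mathbb{N}$ with $n\geq 2$ and every $\beta\in\mathbb{N}^n$.
   Context: $\mathbb{N}=\{1,2,3,\dots\}$. For a continuous map $g:X\to X$, $U\subseteq X$ and $\delta>0$, let $N_g(U,\delta)=\{k\in\mathbb{N}: \exists x,y\in U \text{ with } d(g^k(x),g^k(y))>\delta\}$. For $\beta=(m_1,\dots,m_n)\in\mathbb{N}^n$, $n\ge 2$: - $(X,f)$ is multi-sensitive with respect to $\beta$ if there is $\delta>0$ such that for all nonempty open sets $U_1,\dots,U_n\subseteq X$, $\bigcap_{i=1}^n N_{f^{m_i}}(U_i,\delta)\neq\emptyset$. - $(X,f)$ is $\mathcal{N}$-sensitive if for every $n\geq 2$ it is multi-sensitive with respect to $(1,2,\dots,n)$ (the constant $\delta$ may depend on $n$). - $(X,f)$ is $\beta$-$n$-sensitive if there is $\delta>0$ such that for every nonempty open $U\subseteq X$ there are $k\in\mathbb{N}$ and $x_1,\dots,x_n\in U$ with $\min_{1\leq i<j\leq n}d(f^{m_ik}(x_i),f^{m_jk}(x_j))>\delta$. *)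

(* Defs.v *)
From mathcomp Require Import all_boot all_order all_algebra.
From mathcomp Require Import all_classical all_reals.
From mathcomp Require Import topology.

Set Implicit Arguments.
Unset Strict Implicit.
Unset Printing Implicit Defensive.

Local Open Scope classical_set_scope.
Local Open Scope ring_scope.

Definition locally_connected (T : topologicalType) : Prop :=
  forall (x : T) (U : set T), nbhs x U ->
    exists V : set T, [/\ open V, V x, connected V & V `<=` U].

Section Sensitivity.
Context {R : realType} {X : metricType R}.

(* Positive integers are represented by [nat] together with an explicit
   positivity condition, since [nat] contains 0. *)
Definition separation_times (g : X -> X) (U : set X) (delta : R) : set nat :=
  [set k | (0 < k)%N /\
    exists x y, [/\ U x, U y & delta < mdist (iter k g x) (iter k g y)]].

Definition multi_sensitive (f : X -> X) (n : nat) (beta : 'I_n -> nat) : Prop :=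
  exists2 delta : R, 0 < delta &
    forall U : 'I_n -> set X,
      (forall i, open (U i)) -> (forall i, U i !=set0) ->
      \bigcap_(i in [set: 'I_n])
        separation_times (iter (beta i) f) (U i) delta !=set0.

(* [i : 'I_n] ranges over 0, ..., n-1, so [i.+1] enumerates (1, 2, ..., n). *)
Definition N_sensitive (f : X -> X) : Prop :=
  forall n : nat, (2 <= n)%N -> multi_sensitive f (fun i : 'I_n => i.+1).

(* For n >= 2 the minimum over pairs i < j is over a nonempty finite set, so it
   exceeds [delta] exactly when each of the distances does. *)
Definition beta_sensitive (f : X -> X) (n : nat) (beta : 'I_n -> nat) : Prop :=
  exists2 delta : R, 0 < delta &
    forall U : set X, open U -> U !=set0 ->
      exists (k : nat) (x : 'I_n -> X),
        [/\ (0 < k)%N, (forall i, U (x i)) &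
            forall i j : 'I_n, (i < j)%N ->
              delta < mdist (iter (beta i * k)%N f (x i))
                            (iter (beta j * k)%N f (x j))].

Definition strongly_beta_sensitive (f : X -> X) : Prop :=
  forall (n : nat) (beta : 'I_n -> nat),
    (2 <= n)%N -> (forall i, (0 < beta i)%N) -> beta_sensitive f beta.

End Sensitivity.

(* Main.v *)
Require Import Defs.
From mathcomp Require Import all_boot all_order all_algebra.
From mathcomp Require Import all_classical all_reals.
From mathcomp Require Import topology normedtype.
From mathcomp Require Import lra.

Import Order.TTheory GRing.Theory Num.Theory.
Import numFieldNormedType.Exports.

Local Open Scope classical_set_scope.
Local Open Scope ring_scope.

(** A nonempty open set [U] contains a nonempty connected open set [V], and
    N-sensitivity applied to copies of [V] gives a common time [k] at which
    every image of [V] under [f^(m k)], for [m] up to the largest [beta i], has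
    diameter more than [delta]. Those images are connected, so on each of them
    the distance to a suitable point takes all values in [[0, delta]], while
    balls of radius [e] around [n] prescribed points only account for [n]
    intervals of length [2e]. Points at mutual distance more than [e] can thus
    be picked greedily, one in each image. *)

(** Pigeonhole: consecutive candidates are [3e] apart, so each element of [s] lies within [e] of at
    most one of them, and there are [size s + 1] candidates. *)
Lemma far_multiple (R : realDomainType) (e : R) (s : seq R) : 0 < e ->
  exists2 k : nat, (k <= size s)%N &
    forall r, r \in s -> e < `|e * 3 * k%:R - r|.
Proof.
move=> e0; apply: contrapT => far.
have /choice[g gP] (k : 'I_(size s).+1) :
    exists r, r \in s /\ `|e * 3 * k%:R - r| <= e.
  apply: contrapT => nex; apply: far; exists k; first by rewrite -ltnS.
  by move=> r rs; rewrite ltNge; apply/negP => re; apply: nex; exists r.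
have g_inj : injective g.
  move=> i j gij; apply/val_inj/eqP; rewrite /= -(eqr_nat R).
  have [_] := gP i; have [_] := gP j; rewrite gij !ler_norml.
  move=> /andP[j1 j2] /andP[i1 i2].
  have [ij|ij|/val_inj->//] := ltngtP i j.
    move: ij; rewrite -(ler_nat R) -addn1 natrD => ij; nra.
  move: ij; rewrite -(ler_nat R) -addn1 natrD => ij; nra.
have := @uniq_leq_size _ [seq g i | i : 'I_(size s).+1] s.
rewrite size_map size_enum_ord ltnn map_inj_uniq// enum_uniq => H.
suff: false by []; apply: H => // _ /mapP[i _ ->].
by have [] := gP i.
Qed.

Section MetricSpace.
Context {R : realType} {X : metricType R}.

Lemma mdist_continuous (a : X) : continuous (mdist a : X -> R).
Proof.
move=> x; apply/cvgrPdist_lt => e e0.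
near=> y.
have : ball x e y by near: y; exact: nbhsx_ballx.
rewrite ballEmdist/= => xy.
have := metric_triangle a x y; have := metric_triangle a y x.
by rewrite (metric_sym y x) ltr_norml; lra.
Unshelve. all: by end_near. Qed.

(** By the triangle inequality it is enough that [mdist a y] differs by more than [e] from every
    [mdist a z]. Connectedness lets [mdist a y] be the multiple of [3e] from [far_multiple], which
    lies between 0 and [mdist a b]. *)
Lemma connected_far_point (C : set X) (a b : X) (s : seq X) (e : R) :
  connected C -> C a -> C b -> 0 < e -> e * 3 * (size s)%:R <= mdist a b ->
  exists2 y, C y & forall z, z \in s -> e < mdist z y.
Proof.
move=> Cconn Ca Cb e0 ab.
have [k ks far] := @far_multiple _ e [seq mdist a z | z <- s] e0.
rewrite size_map in ks.
have /connected_intervalP intC : connected (mdist a @` C).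
  by apply/connected_continuous_connected/continuous_subspaceT/mdist_continuous.
have [|||y Cy yE] := intC (mdist a a) (mdist a b) _ _ (e * 3 * k%:R).
- by exists a.
- by exists b.
- rewrite mdistxx; apply/andP; split; first by rewrite !mulr_ge0// ltW.
  by apply: le_trans ab; rewrite ler_pM2l ?mulr_gt0// ler_nat.
exists y => // z zs; have := far _ (map_f (mdist a) zs); rewrite -yE => ez.
apply: (lt_le_trans ez); have := metric_triangle a y z.
have := metric_triangle a z y.
by rewrite ler_norml (metric_sym y z); lra.
Qed.

Lemma connected_separated_points (n : nat) (C : 'I_n -> set X) (e : R) :
  0 < e -> (forall i, connected (C i)) ->
  (forall i, exists a b, [/\ C i a, C i b & e * 3 * n%:R <= mdist a b]) ->
  exists y : 'I_n -> X, (forall i, C i (y i)) /\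
    forall i j : 'I_n, (i < j)%N -> e < mdist (y i) (y j).
Proof.
move=> e0; elim: n C => [|n IHn] C Cconn Cwide.
  have y : 'I_0 -> X by case.
  by exists y; split=> -[].
(* The set of index [ord_max] is treated last: its point has to avoid the [n] points already chosen
   in the others. *)
have [//|i|y [yC y_sep]] := IHn (fun i => C (lift ord_max i)).
  have [a [b [Ca Cb ab]]] := Cwide (lift ord_max i); exists a, b; split=> //.
  by apply: le_trans ab; rewrite ler_pM2l ?mulr_gt0// ler_nat.
have [a [b [Ca Cb ab]]] := Cwide ord_max.
have [|z zC zfar] := @connected_far_point _ a b (codom y) e
    (Cconn ord_max) Ca Cb e0.
  rewrite size_codom card_ord; apply: le_trans ab.
  by rewrite ler_pM2l ?mulr_gt0// ler_nat.
exists (fun i => if unlift ord_max i is Some j then y j else z); split=> [i|i j].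
  by case: unliftP => [j|] ->.
case: (unliftP ord_max i) => [i' ->|->]; last first.
  by rewrite ltnNge -ltnS ltn_ord.
case: (unliftP ord_max j) => [j' ->|-> _]; last exact/zfar/codom_f.
by rewrite !lift_max; exact: y_sep.
Qed.

Lemma continuous_iter (f : X -> X) (k : nat) :
  continuous f -> continuous (iter k f).
Proof.
move=> fcont; elim: k => [|k IHk] x; first exact: cvg_id.
by apply: (@continuous_comp _ _ _ (iter k f) f); [exact: IHk|exact: fcont].
Qed.

End MetricSpace.

Theorem theorem2 (R : realType) (X : metricType R) (f : X -> X) :
  locally_connected X -> continuous f ->
  N_sensitive f -> strongly_beta_sensitive f.
Proof.
move=> Xlc fcont fN n beta n2 beta0.
(* [N_sensitive] asks for length at least 2, and 1, ..., [N] must contain every [beta i]. *)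
pose N := maxn 2 (\max_i beta i).
have [d d0 fd] := fN N (leq_maxl _ _).
have n0 : 0 < n%:R :> R by rewrite ltr0n (ltn_trans _ n2).
(* For this [e], the width [e * 3 * n] required of the connected images is exactly [d]. *)
have e0 : 0 < d / (3 * n%:R) by rewrite divr_gt0// mulr_gt0.
exists (d / (3 * n%:R)) => // U Uop [u Uu].
have [V [Vop Vu Vconn VU]] := Xlc u U (open_nbhs_nbhs (conj Uop Uu)).
have [|i|k kV] := fd (fun=> V); [by []|by exists u|].
have k0 : (0 < k)%N.
  by have [] := kV (Ordinal (leq_maxl 2 (\max_i beta i) : (1 < N)%N)) I.
have [i|i|y [yC y_sep]] := @connected_separated_points R X n
    (fun i => iter (beta i * k) f @` V) (d / (3 * n%:R)) e0.
- apply/connected_continuous_connected/continuous_subspaceT => //.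
  exact: continuous_iter.
(* Indices start at 0, so the exponent [beta i] sits at index [(beta i).-1]. *)
- have iN : ((beta i).-1 < N)%N.
    by rewrite prednK// leq_max (leq_bigmax i) orbT.
  have [_ [a [b [Va Vb]]]] := kV (Ordinal iN) I.
  rewrite /= prednK// -!iterM mulnC => ab.
  exists (iter (beta i * k) f a), (iter (beta i * k) f b).
  split; [by exists a|by exists b|].
  by rewrite -mulrA divfK ?ltW// mulf_neq0// ?gt_eqF.
have /choice[x xP] i : exists x, V x /\ iter (beta i * k) f x = y i.
  by have [x] := yC i; exists x.
exists k, x; split=> // [i|i j ij]; first by apply: VU; case: (xP i).
by case: (xP i) => _ ->; case: (xP j) => _ ->; exact: y_sep.
Qed.
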